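(* Let $(X,d)$ be a nonempty metric space, let $k\geq 2$ be an integer, and let $1\leq p<\infty$. The following are equivalent. (1) There exists a nonempty metric space $(P,d_P)$ such that $(X,d)$ is isometric (via a bijective isometry) to $P^k$ with the metric $d_{P^k,p}(u,v)=\left(\sum_{j=1}^kd_P(u_j,v_j)^p\right)^{1/p}$. (2) There exist equivalence relations $E_1,\dots,E_k$ on $X$ such that: (a) the quotient distance $\bar d_{E_j}$ is a metric on $X/E_j$ for each $j$; (b) for every choice of classes $C_j\in X/E_j$, $1\leq j\leq k$, the intersection $\bigcap_{j=1}^kC_j$ consists of exactly one point; (c) for all $x,y\in X$, $d(x,y)=\left(\sum_{j=1}^k\bar d_{E_j}([x]_{E_j},[y]_{E_j})^p\right)^{1/p}$; (d) there exists a metric space $(P,d_P)$ such that each metric space $(X/E_j,\bar d_{E_j})$ is isometric to $(P,d_P)$.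
   Context: For an equivalence relation $E$ on a metric space $(X,d)$, $[x]_E$ is the $E$-class of $x$, and $\bar d_E([x]_E,[y]_E):=\inf\{d(x',y'):x'\,E\,x,\ y'\,E\,y\}$ is the quotient distance on $X/E$. All metric spaces are nonempty, and ''isometric'' means related by a bijective isometry. *)

(* Defs.v *)
From HB Require Import structures.
From mathcomp Require Import all_boot all_order all_algebra generic_quotient.
From mathcomp Require Import all_classical all_reals all_analysis.

Set Implicit Arguments.
Unset Strict Implicit.
Unset Printing Implicit Defensive.

Import Order.TTheory GRing.Theory Num.Theory.

Local Open Scope classical_set_scope.
Local Open Scope ring_scope.
Local Open Scope quotient_scope.

Section Metrics.
Variable R : realType.

Definition is_metric (T : Type) (d : T -> T -> R) : Prop :=
  [/\ forall x y, 0 <= d x y,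
      forall x y, d x y = 0 <-> x = y,
      forall x y, d x y = d y x
    & forall x y z, d x z <= d x y + d y z].

Definition isometric (S T : Type) (dS : S -> S -> R) (dT : T -> T -> R) : Prop :=
  exists f : S -> T, bijective f /\ forall x y, dT (f x) (f y) = dS x y.

Definition lp_norm (k : nat) (p : R) (a : 'I_k -> R) : R :=
  (\sum_(j < k) a j `^ p) `^ p^-1.

Definition lp_dist (k : nat) (p : R) (P : metricType R)
    (u v : {ffun 'I_k -> P}) : R :=
  lp_norm p (fun j => mdist (u j) (v j)).

Section Quotient.
Variables (X : metricType R) (E : equiv_rel X).

Definition class_of (x : X) : {eq_quot E} := \pi_{eq_quot E} x.

Definition class_set (C : {eq_quot E}) : set X := [set x | class_of x = C].

(* [inf] is a genuine infimum here: classes are nonempty and distances are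
   bounded below by 0. *)
Definition quot_dist (C D : {eq_quot E}) : R :=
  inf [set mdist x y | x in class_set C & y in class_set D].

End Quotient.
End Metrics.

(* Main.v *)
Require Import Defs.
From mathcomp Require Import all_boot all_order all_algebra generic_quotient.
From mathcomp Require Import all_classical all_reals all_analysis.

Import Order.TTheory GRing.Theory Num.Theory.

Local Open Scope classical_set_scope.
Local Open Scope ring_scope.
Local Open Scope quotient_scope.

(** A power structure on [X] amounts to [k] equivalence relations, the fibres
    of the coordinates.

    From a power to the relations: given a bijective isometry [f : X -> P^k],
    let [x E_j y] mean that [f x] and [f y] have the same [j]-th coordinate.
    The point is that the quotient distance between two [E_j]-classes is the
    distance in [P] of their [j]-th coordinates ([quot_dist_fibre]). It cannot
    be smaller, because an l^p norm dominates each of its coordinates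
    ([lp_norm_ge_coord]); and it is attained, because [f] is onto: move [x]
    into the class of [y] by changing its [j]-th coordinate only, at a cost
    which is exactly the distance of these coordinates ([lp_norm_single]).
    Hence the [j]-th coordinate identifies [X / E_j] with [P]
    ([fibre_quotient_isometric]), and the other conditions transcribe the
    product structure.

    From the relations to a power: identify each [X / E_j] with [P]; the tuple
    of the classes of [x] is then a point of [P^k]. Because classes, one for
    each [E_j], meet in exactly one point, [x |-> ([x]_(E_1), ..., [x]_(E_k))]
    is a bijection ([classes_bijective]); the formula for the distance of [X]
    says that it is an isometry. *)

Section LpNorm.
Variables (R : realType) (k : nat) (p : R).
Hypothesis p_gt0 : 0 < p.

Lemma powRK (a : R) : 0 <= a -> (a `^ p) `^ p^-1 = a.
Proof. by move=> a0; rewrite -powRrM divff ?gt_eqF// powRr1. Qed.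

Lemma lp_norm_ge_coord (a : 'I_k -> R) (j : 'I_k) :
  0 <= a j -> a j <= lp_norm p a.
Proof.
move=> aj0; rewrite -[leLHS]powRK// /lp_norm.
apply: ge0_ler_powR; rewrite ?invr_ge0 ?(ltW p_gt0) ?nnegrE ?powR_ge0//.
  by apply: sumr_ge0 => i _; exact: powR_ge0.
by rewrite (bigD1 j)//= lerDl; apply: sumr_ge0 => i _; exact: powR_ge0.
Qed.

Lemma lp_norm_single (a : 'I_k -> R) (j : 'I_k) :
  0 <= a j -> (forall i, i != j -> a i = 0) -> lp_norm p a = a j.
Proof.
move=> aj0 a0; rewrite /lp_norm (bigD1 j)//= big1 ?addr0 ?powRK// => i /a0 ->.
by rewrite powR0// gt_eqF.
Qed.

End LpNorm.

Lemma inf_attained (R : realType) (A : set R) (m : R) :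
  A m -> lbound A m -> inf A = m.
Proof.
move=> Am lbm; apply/eqP; rewrite eq_le; apply/andP; split.
  by apply: ge_inf => //; exists m.
by apply: lb_le_inf => //; exists m.
Qed.

Lemma isometric_is_metric (R : realType) (S : Type) (d : S -> S -> R)
    (P : metricType R) :
  isometric d (mdist : P -> P -> R) -> is_metric d.
Proof.
move=> [h [/bij_inj h_inj hd]]; split => [x y|x y|x y|x y z]; rewrite -!hd.
- exact: mdist_ge0.
- by split=> [/mdist_positivity/h_inj//|->]; rewrite mdistxx.
- exact: metric_sym.
- exact: metric_triangle.
Qed.

Section ClassOf.
Variables (R : realType) (X : metricType R) (E : equiv_rel X).

Lemma class_ofP (x y : X) : reflect (class_of E x = class_of E y) (E x y).
Proof. exact: eqmodP. Qed.

Lemma class_of_repr (C : {eq_quot E}) : class_of E (repr C) = C.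
Proof. exact: reprK. Qed.

End ClassOf.

(** * From a power to equivalence relations *)

Section Fibres.
Variables (R : realType) (X P : metricType R) (k : nat) (p : R).
Hypothesis p_gt0 : 0 < p.
Variables (f : X -> {ffun 'I_k -> P}) (g : {ffun 'I_k -> P} -> X).
Hypotheses (fK : cancel f g) (gK : cancel g f).
Hypothesis f_isom : forall x y, lp_dist p (f x) (f y) = mdist x y.

Definition fibre_rel (j : 'I_k) : rel X := fun x y => f x j == f y j.

Lemma fibre_rel_refl j : reflexive (fibre_rel j).
Proof. by move=> x; rewrite /fibre_rel eqxx. Qed.

Lemma fibre_rel_sym j : symmetric (fibre_rel j).
Proof. by move=> x y; rewrite /fibre_rel eq_sym. Qed.

Lemma fibre_rel_trans j : transitive (fibre_rel j).
Proof. by move=> y x z /eqP xy /eqP yz; rewrite /fibre_rel xy yz. Qed.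

Definition fibre (j : 'I_k) : equiv_rel X :=
  EquivRel (fibre_rel j) (@fibre_rel_refl j) (@fibre_rel_sym j)
    (@fibre_rel_trans j).

Lemma class_of_fibreP j x y :
  class_of (fibre j) x = class_of (fibre j) y <-> f x j = f y j.
Proof.
by split=> [/class_ofP/eqP//|fxy]; apply/class_ofP; apply/eqP.
Qed.

(** The infimum is a minimum, attained at [x] and at the point of the class of
    [y] which differs from [x] in the coordinate [j] only. *)
Lemma quot_dist_fibre j x y :
  quot_dist (class_of (fibre j) x) (class_of (fibre j) y) =
  mdist (f x j) (f y j).
Proof.
apply: inf_attained.
- exists x => //.
  exists (g [ffun i => if i == j then f y j else f x i]).
    by apply/class_of_fibreP; rewrite gK ffunE eqxx.
  rewrite -f_isom gK /lp_dist (lp_norm_single _ _ p p_gt0 _ j) ?mdist_ge0//.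
    by rewrite ffunE eqxx.
  by move=> i /negPf ij; rewrite ffunE ij mdistxx.
- move=> _ [x' /class_of_fibreP <-] [y' /class_of_fibreP <-] <-.
  rewrite -f_isom /lp_dist.
  by apply: (lp_norm_ge_coord _ _ p p_gt0 (fun i => mdist (f x' i) (f y' i)));
    exact: mdist_ge0.
Qed.

(** Constant tuples give a section of each coordinate, hence surjectivity. *)
Lemma fibre_quotient_isometric j :
  isometric (@quot_dist R X (fibre j)) (mdist : P -> P -> R).
Proof.
exists (fun C => f (repr C) j); split; last first.
  by move=> C D; rewrite -quot_dist_fibre !class_of_repr.
exists (fun a => class_of (fibre j) (g [ffun=> a])) => [C|a].
  rewrite -[RHS]class_of_repr; apply/class_of_fibreP.
  by rewrite gK ffunE.
have /class_of_fibreP -> := class_of_repr _ _ _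
  (class_of (fibre j) (g [ffun=> a])).
by rewrite gK ffunE.
Qed.

Lemma fibre_classes_meet (C : forall j, {eq_quot (fibre j)}) :
  exists x : X, \bigcap_(j in [set: 'I_k]) class_set (C j) = [set x].
Proof.
exists (g [ffun j => f (repr (C j)) j]); apply/seteqP; split=> [x Cx|_ -> j _].
  apply: (can_inj fK); rewrite gK; apply/ffunP => j; rewrite ffunE.
  by apply/class_of_fibreP; rewrite class_of_repr; exact: Cx.
by rewrite /class_set/= -[RHS]class_of_repr; apply/class_of_fibreP;
  rewrite gK ffunE.
Qed.

Lemma lp_norm_fibres x y :
  mdist x y =
  lp_norm p (fun j => quot_dist (class_of (fibre j) x) (class_of (fibre j) y)).
Proof.
rewrite -f_isom /lp_dist; congr lp_norm.
by apply/funext => j; rewrite quot_dist_fibre.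
Qed.

End Fibres.

(** * From equivalence relations to a power *)

Section Classes.
Variables (R : realType) (X P : metricType R) (k : nat).
Variable E : 'I_k -> equiv_rel X.
Hypothesis classes_meet : forall C : (forall j, {eq_quot (E j)}),
  exists x : X, \bigcap_(j in [set: 'I_k]) class_set (C j) = [set x].
Variable h : forall j, {eq_quot (E j)} -> P.
Hypothesis h_bij : forall j, bijective (h j).

(** By [classes_meet] a point is determined by its classes, and every tuple of
    classes is the tuple of classes of a point. *)
Lemma classes_bijective :
  bijective (fun x : X => [ffun j => h j (class_of (E j) x)]).
Proof.
have /fin_all_exists[h' h'P] j :
    exists h', cancel (h j) h' /\ cancel h' (h j).
  by have [h' hK h'K] := h_bij j; exists h'.
have /choice[g gP] (u : {ffun 'I_k -> P}) : exists x : X,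
    \bigcap_(j in [set: 'I_k]) class_set (h' j (u j)) = [set x].
  exact: classes_meet (fun j => h' j (u j)).
exists g => [x|u].
  set u := finfun _; suff : [set g u] x by [].
  rewrite -gP => j _.
  by rewrite /class_set/= ffunE (h'P j).1.
apply/ffunP => j; rewrite ffunE.
have : [set g u] (g u) by [].
by rewrite -{1}gP => /(_ j I); rewrite /class_set/= => ->; exact: (h'P j).2.
Qed.

End Classes.

Theorem corollary3p20 (R : realType) (X : metricType R) (k : nat) (p : R)
    (X_nonempty : [set: X] !=set0) (k_ge2 : (2 <= k)%N) (p_ge1 : 1 <= p) :
  (exists P : metricType R,
      [set: P] !=set0 /\
      isometric (mdist : X -> X -> R) (@lp_dist R k p P))
  <->
  (exists E : 'I_k -> equiv_rel X,
      [/\ forall j, is_metric (@quot_dist R X (E j)),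
          forall C : (forall j, {eq_quot (E j)}),
            exists x : X, \bigcap_(j in [set: 'I_k]) class_set (C j) = [set x],
          forall x y : X,
            mdist x y =
            lp_norm p (fun j => quot_dist (class_of (E j) x) (class_of (E j) y))
        & exists P : metricType R,
            [set: P] !=set0 /\
            forall j, isometric (@quot_dist R X (E j)) (mdist : P -> P -> R)]).
Proof.
have p_gt0 : 0 < p := lt_le_trans ltr01 p_ge1.
split=> [[P [P0 [f [[g fK gK] f_isom]]]]|[E [_ EC Ed [P [P0 EP]]]]].
- have quotP := fibre_quotient_isometric _ _ _ _ _ p_gt0 _ _ gK f_isom.
  exists (fibre _ _ _ _ f); split=> [j|||].
  + exact: isometric_is_metric (quotP j).
  + exact: fibre_classes_meet fK gK.
  + exact: lp_norm_fibres p_gt0 _ _ gK f_isom.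
  + by exists P; split=> // j; exact: quotP.
- exists P; split=> //.
  have /fin_all_exists[h hP] := EP.
  exists (fun x => [ffun j => h j (class_of (E j) x)]); split.
    by apply: classes_bijective EC _ _ => j; exact: (hP j).1.
  move=> x y; rewrite Ed /lp_dist; congr lp_norm.
  by apply/funext => j; rewrite !ffunE (hP j).2.
Qed.
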